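(* Assume: (BoS) for each $d\in\mathcal D$, $\mathrm{Supp}(Y_d\mid D\ne d)=\mathrm{Supp}(Y_d\mid D=d)=[\underline y_d,\overline y_d]$ with $\underline y_d,\overline y_d\in\mathbb R$; (SDC) $\mathrm{Cov}(Y_d,D)\,\mathrm{Cov}(Y_d,Z)\ge 0$ for each $d\in\mathcal D$; (LEI) $|\rho_{Y_dD}|\ge|\rho_{Y_dZ}|$ for each $d\in\mathcal D$. Then for each $d\in\mathcal D$, the potential outcome mean $\theta_d=\mathrm{E}[Y_d]$ satisfies $\theta_d\in I^d_{LEI}:= I^d_{LEI1}\cup I^d_{LEI2}$, where $$I_{LEI1}^d=\Big[\sup_{(\alpha,\beta,\mu)\in[0,1]^3}\mathrm{E}\big[\underline f_d(Y,D,\delta_L^-)\big],\ \inf_{(\alpha,\beta,\mu)\in[0,1]^3}\mathrm{E}\big[\overline f_d(Y,D,\delta_L^+)\big]\Big],$$ $$I_{LEI2}^d=\Big[\sup_{(\alpha,\beta,\mu)\in[0,1]^3}\mathrm{E}\big[\underline f_d(Y,D,\delta_L^+)\big],\ \inf_{(\alpha,\beta,\mu)\in[0,1]^3}\mathrm{E}\big[\overline f_d(Y,D,\delta_L^-)\big]\Big].$$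
   Context: Setting: all random variables live on one probability space. $D$ is a discrete random variable (treatment) with values in $\mathcal D=\{1,\dots,T\}$; for each $d\in\mathcal D$, $Y_d$ is an integrable real random variable (potential outcome); the observed outcome is $Y=\sum_{d=1}^T Y_d\,\mathbf 1\{D=d\}$; $Z$ is a real random variable (imperfect instrument). $Y_d$, $D$, $Z$ have finite positive variances; $\sigma_D,\sigma_Z$ are the standard deviations of $D,Z$, and $\rho_{UV}$ is the correlation coefficient of $U$ and $V$. Write $\tilde D=D-\mathrm{E}[D]$, $\tilde Z=Z-\mathrm{E}[Z]$. For $(\alpha,\beta,\mu)\in[0,1]^3$ define $$\delta_L^{\pm}=1\pm\alpha\big((1-\beta)\mu(\tilde D\sigma_Z-\tilde Z\sigma_D)+\beta\tilde D+(1-\beta)(1-\mu)\tilde Z\big).$$ For real (or random) $\delta$ define $$\underline f_d(Y,D,\delta)=\mathbf 1\{D=d\}\,\delta Y+\mathbf 1\{D\ne d\}\min\{\delta\underline y_d,\delta\overline y_d\},$$ $$\overline f_d(Y,D,\delta)=\mathbf 1\{D=d\}\,\delta Y+\mathbf 1\{D\ne d\}\max\{\delta\underline y_d,\delta\overline y_d\}.$$ Here $\mathrm{Supp}(Y_d\mid A)$ is the support of the conditional distribution of $Y_d$ given the event $A$ (assumed of positive probability). An interval $[a,b]$ with $a>b$ is the empty set. *)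

(* Defs.v *)
From HB Require Import structures.
From mathcomp Require Import all_boot all_order all_algebra.
From mathcomp Require Import all_classical all_reals all_analysis.

Set Implicit Arguments.
Unset Strict Implicit.
Unset Printing Implicit Defensive.

Import Order.TTheory GRing.Theory Num.Theory.
Import numFieldNormedType.Exports.

Local Open Scope classical_set_scope.
Local Open Scope ring_scope.

Section Moments.
Context {dsp : measure_display} {Omega : measurableType dsp} {R : realType}.
Variable P : probability Omega R.

Definition stddev (U : Omega -> R) : R := Num.sqrt (fine 'V_P[U]).

Definition correlation (U V : Omega -> R) : R :=
  fine (covariance P U V) / (stddev U * stddev V).

Definition centered (U : Omega -> R) : Omega -> R :=
  fun w => U w - fine 'E_P[U].

Definition cond_law (A : set Omega) (X : Omega -> R) (B : set R) : \bar R :=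
  (P (A `&` X @^-1` B) / P A)%E.

(* Topological support: the points all of whose open neighbourhoods are charged
   by the law. *)
Definition cond_support (X : Omega -> R) (A : set Omega) : set R :=
  [set x | forall U : set R, open U -> U x -> (0 < cond_law A X U)%E].

End Moments.

Section PotentialOutcomes.
Context {dsp : measure_display} {Omega : measurableType dsp} {R : realType}.
Variables (P : probability Omega R) (T : nat).
Implicit Types (D Z : Omega -> R) (d : 'I_T).

(* The treatment levels 1, ..., T are indexed by the ordinals 0, ..., T - 1. *)
Definition level d : R := (d.+1)%:R.

Definition treated D d : set Omega := [set w | D w = level d].
Definition untreated D d : set Omega := [set w | D w <> level d].

Definition observed (Yp : 'I_T -> Omega -> R) D : Omega -> R :=
  fun w => \sum_(d < T) Yp d w * \1_(treated D d) w.

Definition f_lower (ylo yhi : R) d (y t delta : R) : R :=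
  (t == level d)%:R * (delta * y)
  + (t != level d)%:R * Num.min (delta * ylo) (delta * yhi).

Definition f_upper (ylo yhi : R) d (y t delta : R) : R :=
  (t == level d)%:R * (delta * y)
  + (t != level d)%:R * Num.max (delta * ylo) (delta * yhi).

Definition tilt D Z (b m : R) : Omega -> R := fun w =>
  (1 - b) * m * (centered P D w * stddev P Z - centered P Z w * stddev P D)
  + b * centered P D w + (1 - b) * (1 - m) * centered P Z w.

Definition deltaLp D Z (abm : R * R * R) : Omega -> R :=
  fun w => let: (a, b, m) := abm in 1 + a * tilt D Z b m w.

Definition deltaLm D Z (abm : R * R * R) : Omega -> R :=
  fun w => let: (a, b, m) := abm in 1 - a * tilt D Z b m w.

Definition unit_cube : set (R * R * R) := `[0, 1] `*` `[0, 1] `*` `[0, 1].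

Definition sup_E_f_lower (ylo yhi : R) d (Y D : Omega -> R)
    (delta : R * R * R -> Omega -> R) : \bar R :=
  ereal_sup [set 'E_P[fun w => f_lower ylo yhi d (Y w) (D w) (delta abm w)]%E
            | abm in unit_cube].

Definition inf_E_f_upper (ylo yhi : R) d (Y D : Omega -> R)
    (delta : R * R * R -> Omega -> R) : \bar R :=
  ereal_inf [set 'E_P[fun w => f_upper ylo yhi d (Y w) (D w) (delta abm w)]%E
            | abm in unit_cube].

Definition I_LEI1 (ylo yhi : R) d (Y D Z : Omega -> R) : set (\bar R) :=
  [set t | sup_E_f_lower ylo yhi d Y D (deltaLm D Z) <= t
           <= inf_E_f_upper ylo yhi d Y D (deltaLp D Z)]%E.

Definition I_LEI2 (ylo yhi : R) d (Y D Z : Omega -> R) : set (\bar R) :=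
  [set t | sup_E_f_lower ylo yhi d Y D (deltaLp D Z) <= t
           <= inf_E_f_upper ylo yhi d Y D (deltaLm D Z)]%E.

Definition I_LEI (ylo yhi : R) d (Y D Z : Omega -> R) : set (\bar R) :=
  I_LEI1 ylo yhi d Y D Z `|` I_LEI2 ylo yhi d Y D Z.

(* Conditioning on D = d and on D <> d requires both events to be charged. *)
Definition bounded_support (Yp : 'I_T -> Omega -> R) D (ylo yhi : 'I_T -> R) :=
  forall d, [/\ (0 < P (treated D d))%E, (0 < P (untreated D d))%E,
    cond_support P (Yp d) (untreated D d) = `[ylo d, yhi d]%classic &
    cond_support P (Yp d) (treated D d) = `[ylo d, yhi d]%classic].

Definition same_direction_cov (Yp : 'I_T -> Omega -> R) D Z :=
  forall d, (0 <= covariance P (Yp d) D * covariance P (Yp d) Z)%E.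

Definition less_endogenous_instrument (Yp : 'I_T -> Omega -> R) D Z :=
  forall d, `|correlation P (Yp d) Z| <= `|correlation P (Yp d) D|.

End PotentialOutcomes.

(* Main.v *)
Require Import Defs.
From HB Require Import structures.
From mathcomp Require Import all_boot all_order all_algebra.
From mathcomp Require Import all_classical all_reals all_analysis.
From mathcomp Require Import measurable_realfun ring.

Set Implicit Arguments.
Unset Strict Implicit.
Unset Printing Implicit Defensive.

Import Order.TTheory GRing.Theory Num.Theory.
Import numFieldNormedType.Exports.

Local Open Scope classical_set_scope.
Local Open Scope ring_scope.

(* By (SDC) and (LEI), the covariances of Y_d with D and with Z have a common
   sign, and so has Cov(Y_d, tilt) for every tilt in the family, since
   |Cov(Y_d, D)| sigma_Z >= |Cov(Y_d, Z)| sigma_D. As E[(1 + a tilt) Y_d]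
   = E[Y_d] + a Cov(Y_d, tilt), weighting Y_d by delta moves its mean in a known
   direction. Y_d being almost surely in [ylo, yhi], delta Y_d lies between
   f_lower and f_upper. The sign of Cov(Y_d, D) selects the interval. *)

(** * Square integrability and almost sure membership in the support *)

Section Probability.
Context {dsp : measure_display} {Omega : measurableType dsp} {R : realType}.
Variable P : probability Omega R.
Implicit Types X Y : Omega -> R.

(** The variance is the integral of the square of [X - c] for a real constant [c], so its finiteness
    puts [X - c] in L2. Constants lie in L2 of a probability, hence so does [X]. *)
Lemma finite_variance_Lfun2 X :
  measurable_fun setT X -> ('V_P[X] < +oo)%E -> X \in Lfun P 2%:E.
Proof.
move=> mX; rewrite /variance covariance.unlock expectation.unlock.
set c := fine _ => V_fin.
have cX2 : (X \- cst c) \in Lfun P 2%:E.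
  rewrite inE; apply/andP; split; rewrite inE/=.
    exact: measurable_funB.
  rewrite /finite_norm unlock/= poweR_lty//.
  apply: le_lt_trans V_fin; rewrite le_eqVlt; apply/orP; left; apply/eqP.
  by apply: eq_integral => w _; rewrite /= powR_mulrn// real_normK ?num_real.
have -> : X = (X \- cst c) \+ cst c by apply/funext => w /=; rewrite subrK.
by apply: rpredD => [|? //|?]; [rewrite lee1n|exact: Lfun_cst].
Qed.

Lemma Lfun1_measurable X : X \in Lfun P 1 -> measurable_fun setT X.
Proof. by move=> /Lfun1_integrable/measurable_int/measurable_EFinP. Qed.

Lemma Lfun2_measurable X : X \in Lfun P 2%:E -> measurable_fun setT X.
Proof. by rewrite inE => /andP[/[!inE]]. Qed.

Lemma Lfun21 X : X \in Lfun P 2%:E -> X \in Lfun P 1.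
Proof. by apply: Lfun_subset12; rewrite fin_num_measure. Qed.

Lemma covariance_Lfun2_fin_num X Y : X \in Lfun P 2%:E -> Y \in Lfun P 2%:E ->
  covariance P X Y \is a fin_num.
Proof.
move=> X2 Y2; apply: covariance_fin_num; try exact: Lfun21.
exact: Lfun2_mul_Lfun1.
Qed.

Lemma Lfun1_le X Y : measurable_fun setT X -> (forall w, `|X w| <= `|Y w|) ->
  Y \in Lfun P 1 -> X \in Lfun P 1.
Proof.
move=> mX XY /Lfun1_integrable iY; apply/Lfun1_integrable.
apply: le_integrable iY => //; first exact/measurable_EFinP.
by move=> w _; rewrite lee_fin.
Qed.

Lemma ae_le_expectation X Y : X \in Lfun P 1 -> Y \in Lfun P 1 ->
  {ae P, forall w, X w <= Y w} -> ('E_P[X] <= 'E_P[Y])%E.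
Proof.
move=> X1 Y1 XY; rewrite -sube_ge0 ?expectation_fin_num ?orbT//.
have YX1 : Y \- X \in Lfun P 1 by rewrite rpredB.
rewrite -expectationB// unlock.
(* [Y - X] is nonnegative only almost surely, so it is replaced under the integral by its absolute
   value, which is nonnegative everywhere. *)
rewrite (ae_eq_integral (fun w => `|(Y w - X w)%:E|)%E) ?integral_ge0//.
- exact/measurable_EFinP/Lfun1_measurable.
- exact/measurableT_comp/measurable_EFinP/Lfun1_measurable.
- apply: filterS XY => w XYw _.
  by rewrite /= ger0_norm ?subr_ge0.
Qed.

(* Second countability: rational intervals suffice to cover the complement of
   the support. *)
Lemma ae_cond_support X (A : set Omega) :
  measurable_fun setT X -> measurable A -> (0 < P A)%E ->
  {ae P, forall w, A w -> cond_support P X A (X w)}.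
Proof.
move=> mX mA PA_gt0.
pose I (pq : rat * rat) : set R := `]ratr pq.1, ratr pq.2[%classic.
pose N (pq : rat * rat) : set Omega := A `&` X @^-1` I pq.
have mN pq : measurable (N pq).
  apply: measurableI => //; rewrite -[_ @^-1` _]setTI; apply: mX => //.
  exact: measurable_itv.
(* [F] enumerates the sets [N pq] of measure zero. Indices that code no pair, or a charged set, give
   the empty set, so that every [F n] is negligible. *)
pose F (n : nat) : set Omega :=
  if unpickle n is Some pq then
    if P (N pq) == 0%E then N pq else set0 else set0.
have FN n : P.-negligible (F n).
  rewrite /F; case: unpickle => [pq|]; last exact: negligible_set0.
  case: ifPn => [/eqP N0|_]; last exact: negligible_set0.
  exact/negligibleP.
apply: negligibleS (negligible_bigcup FN).
move=> w /= /not_implyP[Aw /existsNP[U]].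
move=> /not_implyP[oU] /not_implyP[UX] /negP; rewrite -leNgt => condU.
have PU0 : P (A `&` X @^-1` U) = 0%E.
  apply/eqP; rewrite eq_le measure_ge0 andbT leNgt; apply/negP => PU_gt0.
  move: condU; apply/negP; rewrite -ltNge /cond_law mule_gt0//.
  rewrite inve_gt0//; first by rewrite gt_eqF.
  by rewrite -ltey -ge0_fin_numE ?fin_num_measure.
(* The open set [U] witnessing that [X w] is outside the support is shrunk to an interval around
   [X w], then to one with rational endpoints [p < X w < q]. The latter is null too, so [w] lies in
   some [F n]. *)
have [e e_gt0 eU] :
    exists2 e : R, 0 < e & `]X w - e, X w + e[%classic `<=` U.
  near (0 : R)^'+ => e; exists e; first by near: e; exact: nbhs_right_gt.
  by near: e; exact: open_itvoo_subset.
have [|p /[!in_itv]/= /andP[p1 p2]] := @rat_in_itvoo R (X w - e) (X w).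
  by rewrite ltrBlDr ltrDl.
have [|q /[!in_itv]/= /andP[q1 q2]] := @rat_in_itvoo R (X w) (X w + e).
  by rewrite ltrDl.
have NU : N (p, q) `<=` A `&` X @^-1` U.
  move=> v [Av]; rewrite /I/= in_itv/= => /andP[pv vq]; split => //.
  by apply: eU; rewrite /= in_itv/= (lt_trans p1)//= (lt_trans vq).
have PN0 : P (N (p, q)) = 0%E.
  apply/eqP; rewrite eq_le measure_ge0 andbT -PU0 le_measure// ?inE//.
  apply: measurableI => //; rewrite -[_ @^-1` _]setTI; apply: mX => //.
  exact: open_measurable.
have FE : F (pickle (p, q)) = N (p, q) by rewrite /F pickleK PN0 eqxx.
exists (pickle (p, q)); first exact: Logic.I.
by rewrite FE; split => //; rewrite /I/= in_itv/= p2 q1.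
Unshelve. all: by end_near.
Qed.

End Probability.

(** * Comparison of the bounding functions with the weighted outcome *)

Section PotentialOutcomes.
Context {dsp : measure_display} {Omega : measurableType dsp} {R : realType}.
Variables (P : probability Omega R) (T : nat).
Variables (Yp : 'I_T -> Omega -> R) (D : Omega -> R).
Implicit Types (lo hi y t delta : R) (d : 'I_T).

Lemma level_inj : injective (@level R T).
Proof. by move=> d e /eqP; rewrite eqr_nat eqSS => /eqP/val_inj. Qed.

Lemma observed_treated d w : D w = level d -> observed Yp D w = Yp d w.
Proof.
move=> Dw; rewrite /observed (bigD1 d)//= big1 ?addr0 => [|e ed].
  by rewrite indicE mem_set ?mulr1.
rewrite indicE memNset ?mulr0// /treated/= Dw => /level_inj de.
by rewrite de eqxx in ed.
Qed.

Lemma f_lower_observed lo hi d w delta :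
  f_lower lo hi d (observed Yp D w) (D w) delta =
  if D w == level d then delta * Yp d w else Num.min (delta * lo) (delta * hi).
Proof.
rewrite /f_lower; case: eqP => [/observed_treated->|_] /=.
  by rewrite mul1r mul0r addr0.
by rewrite mul0r mul1r add0r.
Qed.

(** This symmetry lets the upper estimate be deduced from the lower one. *)
Lemma f_upperE lo hi d y t delta :
  f_upper lo hi d y t delta = - f_lower lo hi d y t (- delta).
Proof.
by rewrite /f_upper /f_lower !mulNr -oppr_max !mulrN opprD !opprK.
Qed.

(** The weight [delta] may be negative: the bound comes from [lo] when [delta] is nonnegative and
    from [hi] otherwise. *)
Lemma min_scale_le lo hi y delta : lo <= y <= hi ->
  Num.min (delta * lo) (delta * hi) <= delta * y.
Proof.
move=> /andP[loy yhi]; rewrite ge_min; have [d0|d0] := leP 0 delta.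
  by rewrite ler_wpM2l.
by rewrite (ler_wnM2l (ltW d0) yhi) orbT.
Qed.

(** Domination by [|delta * Yp d| + (|lo| + |hi|) * |delta|], whose first term is integrable as the
    absolute value of a product of two L2 functions. *)
Lemma f_lower_Lfun1 lo hi d (delta : Omega -> R) : measurable_fun setT D ->
  Yp d \in Lfun P 2%:E -> delta \in Lfun P 2%:E ->
  (fun w => f_lower lo hi d (observed Yp D w) (D w) (delta w)) \in Lfun P 1.
Proof.
move=> mD Y2 delta2; have delta1 := Lfun21 delta2.
have mdelta := Lfun2_measurable delta2; have mY := Lfun2_measurable Y2.
apply: (@Lfun1_le _ _ _ P _ (fun w => `|delta w * Yp d w| +
    `|(`|lo| + `|hi|) * delta w|)).
- rewrite (_ : (fun w => _) = fun w => if D w == level d then delta w * Yp d w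
    else Num.min (delta w * lo) (delta w * hi)).
    apply: measurable_fun_ifT.
    - exact: measurable_fun_eqr.
    - exact: measurable_funM.
    - by apply: measurable_minr; apply: measurable_funM.
  by apply/funext => w; exact: f_lower_observed.
- move=> w; rewrite [leRHS]ger0_norm ?addr_ge0// f_lower_observed.
  case: ifPn => _; first by rewrite lerDl.
  apply: (@le_trans _ _ `|(`|lo| + `|hi|) * delta w|); last by rewrite lerDr.
  rewrite [leRHS]normrM (ger0_norm (addr_ge0 (normr_ge0 lo) (normr_ge0 hi))).
  rewrite [leRHS]mulrC.
  rewrite /Num.min; case: ifPn => _; rewrite normrM ler_wpM2l//.
    by rewrite lerDl.
  by rewrite lerDr.
- apply: rpredD; first exact: Lfun_norm (Lfun2_mul_Lfun1 delta2 Y2).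
  rewrite (_ : (fun w => _) = Num.Def.normr \o ((`|lo| + `|hi|) \o* delta)).
    by apply: Lfun_norm; exact: Lfun_scale.
  by apply/funext => w /=; rewrite mulrC.
Qed.

(** The integrands agree where [D] is at level [d]; elsewhere the almost sure bounds on [Yp d] give
    the inequality. *)
Lemma expectation_f_lower_le lo hi d (delta : Omega -> R) :
  measurable_fun setT D -> Yp d \in Lfun P 2%:E -> delta \in Lfun P 2%:E ->
  {ae P, forall w, lo <= Yp d w <= hi} ->
  ('E_P[fun w => f_lower lo hi d (observed Yp D w) (D w) (delta w)]
   <= 'E_P[delta \* Yp d])%E.
Proof.
move=> mD Y2 delta2 Ybnd; apply: ae_le_expectation.
- exact: f_lower_Lfun1.
- exact: Lfun2_mul_Lfun1.
- apply: filterS Ybnd => w Yw; rewrite f_lower_observed; case: ifPn => // _.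
  exact: min_scale_le.
Qed.

Lemma expectation_f_upper_ge lo hi d (delta : Omega -> R) :
  measurable_fun setT D -> Yp d \in Lfun P 2%:E -> delta \in Lfun P 2%:E ->
  {ae P, forall w, lo <= Yp d w <= hi} ->
  ('E_P[delta \* Yp d] <=
   'E_P[fun w => f_upper lo hi d (observed Yp D w) (D w) (delta w)])%E.
Proof.
move=> mD Y2 delta2 Ybnd.
have ndelta2 : \- delta \in Lfun P 2%:E by rewrite rpredN ?lee1n.
have L1 := f_lower_Lfun1 lo hi mD Y2 ndelta2.
have expN (X : Omega -> R) : X \in Lfun P 1 -> ('E_P[\- X] = - 'E_P[X])%E.
  move=> X1; rewrite -[RHS]mulN1e -expectationZl//.
  by congr expectation; apply/funext => w /=; rewrite mulrN1.
rewrite (_ : (fun w => f_upper _ _ _ _ _ _) = \- (fun w =>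
    f_lower lo hi d (observed Yp D w) (D w) ((\- delta) w))); last first.
  by apply/funext => w; rewrite f_upperE.
rewrite expN// leeNr -expN ?Lfun2_mul_Lfun1//.
rewrite [X in (_ <= 'E_P[X])%E](_ : _ = (\- delta) \* Yp d).
  exact: expectation_f_lower_le.
by apply/funext => w /=; rewrite mulNr.
Qed.

End PotentialOutcomes.

(** * Covariance of an outcome with the tilt, and its sign *)

Section Tilt.
Context {dsp : measure_display} {Omega : measurableType dsp} {R : realType}.
Variable P : probability Omega R.
Implicit Types X Y D Z : Omega -> R.

Lemma centered_Lfun2 X : X \in Lfun P 2%:E -> centered P X \in Lfun P 2%:E.
Proof.
by move=> X2; apply: (@rpredB _ _ X (cst _)) => [|//|?];
  [rewrite lee1n|exact: Lfun_cst].
Qed.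

Lemma expectation_centered X : X \in Lfun P 1 -> ('E_P[centered P X] = 0)%E.
Proof.
move=> X1; rewrite (_ : centered P X = X \- cst (fine 'E_P[X]%E))//.
rewrite expectationB ?Lfun_cst// expectation_cst fineK ?expectation_fin_num//.
by rewrite subee ?expectation_fin_num.
Qed.

(** Centering one factor is enough: the mean of [Y] multiplies the mean of [centered P X], which is
    zero. *)
Lemma expectation_mul_centered X Y :
  X \in Lfun P 2%:E -> Y \in Lfun P 2%:E ->
  ('E_P[Y \* centered P X] = covariance P Y X)%E.
Proof.
move=> X2 Y2; have cX2 := centered_Lfun2 X2.
have YcX1 : Y \* centered P X \in Lfun P 1 by exact: Lfun2_mul_Lfun1.
have ccX1 : fine 'E_P[Y]%E \o* centered P X \in Lfun P 1.
  by apply: Lfun_scale => //; exact: Lfun21.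
rewrite covariance.unlock [X in (_ = 'E_P[X])%E](_ : _ =
  Y \* centered P X \- fine 'E_P[Y]%E \o* centered P X).
  rewrite expectationB// expectationZl ?Lfun21//.
  by rewrite expectation_centered ?Lfun21// mule0 sube0.
by apply/funext => w; rewrite /centered !fctE/=; ring.
Qed.

(** For square integrable variables this is the covariance of [Y] with [tilt P D Z b m], expanded by
    linearity. It is real-valued, so that its sign is a matter of real algebra. *)
Definition tilt_cov D Z Y (b m : R) : R :=
  let cD := fine (covariance P Y D) in let cZ := fine (covariance P Y Z) in
  (1 - b) * m * (cD * stddev P Z - cZ * stddev P D)
  + b * cD + (1 - b) * (1 - m) * cZ.

Lemma tilt_Lfun2 D Z (b m : R) :
  D \in Lfun P 2%:E -> Z \in Lfun P 2%:E -> tilt P D Z b m \in Lfun P 2%:E.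
Proof.
move=> D2 Z2; rewrite (_ : tilt _ _ _ _ _ =
  ((1 - b) * m * stddev P Z + b) \o* centered P D \+
  ((1 - b) * (1 - m) - (1 - b) * m * stddev P D) \o* centered P Z).
  by apply: rpredD => [|?|?]; rewrite ?lee1n// Lfun_scale ?ler1n// centered_Lfun2.
by apply/funext => w; rewrite /tilt/=; ring.
Qed.

Lemma one_tilt_Lfun2 D Z (a b m : R) :
  D \in Lfun P 2%:E -> Z \in Lfun P 2%:E ->
  (fun w => 1 + a * tilt P D Z b m w) \in Lfun P 2%:E.
Proof.
move=> D2 Z2; rewrite (_ : (fun w => _) = cst 1 \+ a \o* tilt P D Z b m).
  apply: rpredD => [|?|?]; rewrite ?lee1n ?Lfun_cst//.
  by rewrite Lfun_scale ?ler1n// tilt_Lfun2.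
by apply/funext => w /=; rewrite mulrC.
Qed.

Lemma expectation_one_tilt D Z Y (a b m : R) :
  D \in Lfun P 2%:E -> Z \in Lfun P 2%:E -> Y \in Lfun P 2%:E ->
  ('E_P[(fun w => 1 + a * tilt P D Z b m w)%R \* Y] =
   'E_P[Y] + (a * tilt_cov D Z Y b m)%:E)%E.
Proof.
move=> D2 Z2 Y2.
have YcX1 X : X \in Lfun P 2%:E -> Y \* centered P X \in Lfun P 1.
  by move=> X2; exact: Lfun2_mul_Lfun1 (centered_Lfun2 X2).
(* [kD] and [kZ] are the coefficients of the centered [D] and [Z] once [a * tilt] is regrouped as a
   linear combination of them. *)
set kD := a * ((1 - b) * m * stddev P Z + b).
set kZ := a * ((1 - b) * (1 - m) - (1 - b) * m * stddev P D).
rewrite [X in ('E_P[X] = _)%E](_ : _ =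
  Y \+ (kD \o* (Y \* centered P D) \+ kZ \o* (Y \* centered P Z))).
  have [D1 Z1] : kD \o* (Y \* centered P D) \in Lfun P 1 /\
                 kZ \o* (Y \* centered P Z) \in Lfun P 1.
    by split; apply: Lfun_scale => //; exact: YcX1.
  rewrite expectationD; [|exact: Lfun21|exact: rpredD].
  rewrite expectationD// !expectationZl ?YcX1// !expectation_mul_centered//.
  rewrite -(fineK (covariance_Lfun2_fin_num Y2 D2)).
  rewrite -(fineK (covariance_Lfun2_fin_num Y2 Z2)) -!EFinM -EFinD.
  by congr (_ + _%:E)%E; rewrite /tilt_cov /kD /kZ; ring.
by apply/funext => w; rewrite /tilt /kD /kZ/=; ring.
Qed.

End Tilt.

(** Each of the three summands is nonnegative: [cZ] turns out to be nonnegative like [cD], and the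
    comparison of absolute values then makes [cD * sZ - cZ * sD] nonnegative. *)
Lemma tilt_form_ge0 {R : realFieldType} (sD sZ cD cZ b m : R) :
  0 < sD -> 0 <= cD * cZ -> `|cZ| * sD <= `|cD| * sZ -> 0 <= cD ->
  0 <= b <= 1 -> 0 <= m <= 1 ->
  0 <= (1 - b) * m * (cD * sZ - cZ * sD) + b * cD + (1 - b) * (1 - m) * cZ.
Proof.
move=> sD_gt0 cDZ cZD cD_ge0 /andP[b0 b1] /andP[m0 m1].
have cZ_ge0 : 0 <= cZ.
  (* If [cD = 0], the product condition says nothing on [cZ], but the comparison with [0 < sD]
     forces [cZ = 0]. *)
  move: cD_ge0; rewrite le_eqVlt => /predU1P[cD0|cD_gt0].
    by move: cZD; rewrite -cD0 normr0 mul0r pmulr_lle0// normr_le0 => /eqP->.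
  by rewrite -(pmulr_rge0 _ cD_gt0).
rewrite !ger0_norm// in cZD.
by rewrite !addr_ge0// !mulr_ge0// ?subr_ge0.
Qed.

(** * From the assumptions on the outcomes to the two intervals *)

Section Bounds.
Context {dsp : measure_display} {Omega : measurableType dsp} {R : realType}.
Variable P : probability Omega R.

Lemma ae_bounded_support (T : nat) (Yp : 'I_T -> {RV P >-> R})
    (D : {RV P >-> R}) (ylo yhi : 'I_T -> R) (d : 'I_T) :
  bounded_support P Yp D ylo yhi ->
  {ae P, forall w, ylo d <= Yp d w <= yhi d}.
Proof.
move=> /(_ d)[PA PB suppB suppA].
have mA : measurable (treated D d).
  rewrite -[treated D d]setTI.
  exact: (@measurable_funPT _ _ _ _ D _ [set level d]).
have mB : measurable (untreated D d) by exact: measurableC mA.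
have mY : measurable_fun setT (Yp d) by exact: measurable_funPT.
apply: filterS2 (ae_cond_support mY mA PA) (ae_cond_support mY mB PB) => w.
rewrite suppA suppB /= in_itv/= => Ain Bin.
by have [/Ain|/Bin] := pselect (treated D d w).
Qed.

Lemma stddev_gt0 (X : Omega -> R) : (0 < 'V_P[X] < +oo)%E -> 0 < stddev P X.
Proof. by move=> VX; rewrite sqrtr_gt0 fine_gt0. Qed.

(** Clearing denominators leaves the factor [stddev P X] on both sides, and it cancels. *)
Lemma ler_correlation (X Y Z : Omega -> R) : 0 < stddev P X ->
  0 < stddev P Y -> 0 < stddev P Z ->
  `|correlation P X Z| <= `|correlation P X Y| ->
  `|fine (covariance P X Z)| * stddev P Y <=
  `|fine (covariance P X Y)| * stddev P Z.
Proof.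
move=> sX sY sZ; rewrite /correlation !normrM !normfV !normrM.
rewrite !(gtr0_norm sX, gtr0_norm sY, gtr0_norm sZ).
rewrite ler_pdivrMr ?mulr_gt0// mulrAC ler_pdivlMr ?mulr_gt0//.
by rewrite !(mulrCA _ (stddev P X)) ler_pM2l.
Qed.

Section Intervals.
Variables (T : nat) (Yp : 'I_T -> Omega -> R) (D Z : Omega -> R).
Variables (lo hi : R) (d : 'I_T).
Hypotheses (D2 : D \in Lfun P 2%:E) (Z2 : Z \in Lfun P 2%:E).
Hypothesis Y2 : Yp d \in Lfun P 2%:E.
Hypothesis Ybnd : {ae P, forall w, lo <= Yp d w <= hi}.

(** Absorbing the sign into [a] lets the two estimates that follow be stated for [deltaLp] alone,
    under a sign condition on [a * tilt_cov]. *)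
Lemma deltaLmE a b m : deltaLm P D Z (a, b, m) = deltaLp P D Z (- a, b, m).
Proof. by apply/funext => w; rewrite /deltaLm /deltaLp mulNr. Qed.

Lemma f_lower_deltaLp_le a b m : a * tilt_cov P D Z (Yp d) b m <= 0 ->
  ('E_P[fun w => f_lower lo hi d (observed Yp D w) (D w)
    (deltaLp P D Z (a, b, m) w)] <= 'E_P[Yp d])%E.
Proof.
move=> slope; apply: le_trans (expectation_f_lower_le _ Y2 _ Ybnd) _.
- exact: Lfun2_measurable D2.
- exact: one_tilt_Lfun2.
- by rewrite expectation_one_tilt// geeDl// lee_fin.
Qed.

Lemma f_upper_deltaLp_ge a b m : 0 <= a * tilt_cov P D Z (Yp d) b m ->
  ('E_P[Yp d] <= 'E_P[fun w => f_upper lo hi d (observed Yp D w) (D w)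
    (deltaLp P D Z (a, b, m) w)])%E.
Proof.
move=> slope; apply: le_trans (expectation_f_upper_ge _ Y2 _ Ybnd).
- by rewrite expectation_one_tilt// leeDl// lee_fin.
- exact: Lfun2_measurable D2.
- exact: one_tilt_Lfun2.
Qed.

(** With a nonnegative slope, subtracting the tilt lowers the weighted mean and adding it raises it.
    Both estimates hold at every point of the cube, hence for the supremum and the infimum. *)
Lemma I_LEI1_mean :
  (forall b m, 0 <= b <= 1 -> 0 <= m <= 1 -> 0 <= tilt_cov P D Z (Yp d) b m) ->
  I_LEI1 P lo hi d (observed Yp D) D Z 'E_P[Yp d]%E.
Proof.
move=> slope; apply/andP; split.
- apply: ge_ereal_sup => _ [[[a b] m] [[ha hb] hm] <-].
  rewrite deltaLmE; have /= /andP[a0 a1] := ha; apply: f_lower_deltaLp_le.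
  by rewrite mulNr oppr_le0 mulr_ge0// slope.
- apply: le_ereal_inf_tmp => _ [[[a b] m] [[ha hb] hm] <-].
  have /= /andP[a0 a1] := ha.
  by apply: f_upper_deltaLp_ge; rewrite mulr_ge0// slope.
Qed.

Lemma I_LEI2_mean :
  (forall b m, 0 <= b <= 1 -> 0 <= m <= 1 -> tilt_cov P D Z (Yp d) b m <= 0) ->
  I_LEI2 P lo hi d (observed Yp D) D Z 'E_P[Yp d]%E.
Proof.
move=> slope; apply/andP; split.
- apply: ge_ereal_sup => _ [[[a b] m] [[ha hb] hm] <-].
  have /= /andP[a0 a1] := ha.
  by apply: f_lower_deltaLp_le; rewrite mulr_ge0_le0// slope.
- apply: le_ereal_inf_tmp => _ [[[a b] m] [[ha hb] hm] <-].
  rewrite deltaLmE; have /= /andP[a0 a1] := ha; apply: f_upper_deltaLp_ge.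
  by rewrite mulNr oppr_ge0 mulr_ge0_le0// slope.
Qed.

End Intervals.
End Bounds.

Theorem proposition3p2 (dsp : measure_display) (Omega : measurableType dsp)
    (R : realType) (P : probability Omega R) (T : nat)
    (Yp : 'I_T -> {RV P >-> R}) (D Z : {RV P >-> R}) (ylo yhi : 'I_T -> R)
    (D_range : forall w, exists d : 'I_T, D w = level d)
    (Yp_integrable : forall d, P.-integrable setT (EFin \o Yp d))
    (Yp_var : forall d, (0 < 'V_P[Yp d] < +oo)%E)
    (D_var : (0 < 'V_P[D] < +oo)%E)
    (Z_var : (0 < 'V_P[Z] < +oo)%E)
    (BoS : bounded_support P Yp D ylo yhi)
    (SDC : same_direction_cov P Yp D Z)
    (LEI : less_endogenous_instrument P Yp D Z) :
  forall d : 'I_T,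
    I_LEI P (ylo d) (yhi d) d (observed Yp D) D Z ('E_P[Yp d])%E.
Proof.
move=> d.
have Lfun2 (X : {RV P >-> R}) : (0 < 'V_P[X] < +oo)%E ->
    (X : Omega -> R) \in Lfun P 2%:E.
  move=> /andP[_ VX]; apply: finite_variance_Lfun2 VX.
  exact: measurable_funPT.
have [D2 Z2 Y2] := And3 (Lfun2 _ D_var) (Lfun2 _ Z_var) (Lfun2 _ (Yp_var d)).
have Ybnd := ae_bounded_support d BoS.
have [sD sZ] := (stddev_gt0 D_var, stddev_gt0 Z_var).
have cov_le := ler_correlation (stddev_gt0 (Yp_var d)) sD sZ (LEI d).
have := SDC d; rewrite -(fineK (covariance_Lfun2_fin_num Y2 D2)).
rewrite -(fineK (covariance_Lfun2_fin_num Y2 Z2)) -EFinM lee_fin.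
move=> cov_ge0; have [cD|cD] := leP 0 (fine (covariance P (Yp d) D)).
  by left; apply: I_LEI1_mean => // b m hb hm; exact: tilt_form_ge0.
(* When the covariance with [D] is negative, [tilt_form_ge0] is applied to the opposites of both
   covariances: their product and absolute values are unchanged, while the form changes sign. *)
right; apply: I_LEI2_mean => // b m hb hm; rewrite -oppr_ge0.
rewrite -mulrNN in cov_ge0; rewrite -2![`|fine _|]normrN in cov_le.
rewrite -oppr_gt0 in cD.
have := tilt_form_ge0 sD cov_ge0 cov_le (ltW cD) hb hm.
by congr (0 <= _); rewrite /tilt_cov; ring.
Qed.
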